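(* Let $d\ge2$ and let $E=\{x\in\mathbb R^d_+: x_1+\cdots+x_d=1\}$ be the unit simplex, with $\mathcal P=\{x_i: i=1,\dots,d\}$, $\mathcal Q=\{1-\mathbf 1^\top x\}$ and $M=\{x\in\mathbb R^d: \mathbf 1^\top x=1\}$. Consider the following conditions. (G1) $\nabla r(x)$, $r\in\mathcal Q$, are linearly independent for all $x\in M$. (G2) $(\mathcal Q\cup\{p\})=\mathcal I(M\cap\{p=0\})$ for each $p\in\mathcal P$. (A0) $a\in\mathbb S^d_+$ on $E$. (A1) $a\nabla p=0$ on $M\cap\{p=0\}$ and $\mathcal Gp>0$ on $E\cap\{p=0\}$ for each $p\in\mathcal P$. (A2) $a\nabla q=0$ and $\mathcal Gq=0$ on $M$ for each $q\in\mathcal Q$. Then (G1)--(G2) hold for the state space $E$. Moreover, the operator $\mathcal G$ satisfies (A0)--(A2) if and only if both of the following hold. (i) The matrix $a$ is given by $$a_{ii}(x)=\sum_{j\ne i}\alpha_{ij}x_ix_j,\qquad a_{ij}(x)=-\alpha_{ij}x_ix_j\quad(i\ne j)$$ on $E$ for some $\alpha_{ij}\in\mathbb R_+$ such that $\alpha_{ij}=\alpha_{ji}$ for all $i,j$. (ii) The vector $b$ is given by $$b(x)=\beta+Bx,$$ where $\beta\in\mathbb R^d$ and $B\in\mathbb R^{d\times d}$ satisfy $B^\top\mathbf 1+(\beta^\top\mathbf 1)\mathbf 1=0$ and $\beta_i+B_{ij}>0$ for all $i$ and all $j\ne i$.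
   Context: $\mathrm{Pol}(\mathbb R^d)$ is the ring of polynomials on $\mathbb R^d$ and $\mathrm{Pol}_n(\mathbb R^d)$ the subspace of polynomials of degree at most $n$. $\mathbb S^d$ denotes the real symmetric $d\times d$ matrices and $\mathbb S^d_+$ the positive semidefinite ones. $\mathbb R_+=[0,\infty)$; $\mathbf 1$ is the all-ones vector. For a function $f$ on $\mathbb R^d$, $\{f=0\}=\{x\in\mathbb R^d:f(x)=0\}$. Standing setting: $a:\mathbb R^d\to\mathbb S^d$ and $b:\mathbb R^d\to\mathbb R^d$ satisfy $a_{ij}\in\mathrm{Pol}_2(\mathbb R^d)$ and $b_i\in\mathrm{Pol}_1(\mathbb R^d)$ for all $i,j$, and $\mathcal Gf=\frac12\mathrm{Tr}(a\nabla^2f)+b^\top\nabla f$. For a finite family $\mathcal R$ of polynomials, $(\mathcal R)$ is the ideal of $\mathrm{Pol}(\mathbb R^d)$ generated by $\mathcal R$; for $V\subseteq\mathbb R^d$, $\mathcal I(V)$ is the ideal of all polynomials vanishing on $V$. *)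

(* Defs.v *)
From HB Require Import structures.
From mathcomp Require Import all_boot all_order all_algebra.
From mathcomp Require Import classical_sets reals.
From mathcomp Require Import mpoly.

Set Implicit Arguments.
Unset Strict Implicit.
Unset Printing Implicit Defensive.

Import Order.TTheory GRing.Theory Num.Theory.
Local Open Scope classical_set_scope.
Local Open Scope ring_scope.

(* Points of R^d are column vectors.  Polynomials on R^d are identified with  *)
(* formal polynomials {mpoly R[d]} (R is infinite), so that the gradient and  *)
(* the Hessian are given by the formal partial derivatives p^`M(i).           *)

Section Polynomials.
Variables (R : realType) (d : nat).
Implicit Types (p f : {mpoly R[d]}) (x : 'cV[R]_d).

Definition peval p x : R := p.@[fun i => x i 0].

Definition mxeval m n (A : 'M[{mpoly R[d]}]_(m, n)) x : 'M[R]_(m, n) :=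
  map_mx (peval^~ x) A.

(* msize is the total degree plus one, and 0 for the zero polynomial. *)
Definition Pol (n : nat) : set {mpoly R[d]} := [set p | (msize p <= n.+1)%N].

Definition grad f : 'cV[{mpoly R[d]}]_d := \col_i f^`M(i).

Definition hess f : 'M[{mpoly R[d]}]_d := \matrix_(i, j) (f^`M(i))^`M(j).

Definition zeros f : set 'cV[R]_d := [set x | peval f x = 0].

Definition ideal_of (s : seq {mpoly R[d]}) : set {mpoly R[d]} :=
  [set f | exists c : 'I_(size s) -> {mpoly R[d]},
             f = \sum_(i < size s) c i * s`_i].

Definition vanishing_ideal (V : set 'cV[R]_d) : set {mpoly R[d]} :=
  [set f | forall x, V x -> peval f x = 0].

Definition symmetric_mx (A : 'M[R]_d) : Prop := A^T = A.

Definition psd (A : 'M[R]_d) : Prop :=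
  symmetric_mx A /\ forall v : 'cV[R]_d, 0 <= (v^T *m A *m v) 0 0.

End Polynomials.

Section Diffusion.
Variables (R : realType) (d : nat).
Implicit Types (E M : set 'cV[R]_d) (P Q : seq {mpoly R[d]}).
Implicit Types (a : 'M[{mpoly R[d]}]_d) (b : 'cV[{mpoly R[d]}]_d).

Definition generator a b (f : {mpoly R[d]}) : {mpoly R[d]} :=
  2^-1 *: \tr (a *m hess f) + (b^T *m grad f) 0 0.

Definition polynomial_coefficients a b : Prop :=
  [/\ forall x, symmetric_mx (mxeval a x),
      forall i j, Pol 2 (a i j)
    & forall i, Pol 1 (b i 0)].

Definition condG1 M Q : Prop :=
  forall x, M x -> free [seq mxeval (grad r) x | r <- Q].

Definition condG2 M P Q : Prop :=
  forall p, p \in P ->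
    ideal_of (rcons Q p) = vanishing_ideal (M `&` zeros p).

Definition condA0 E a : Prop := forall x, E x -> psd (mxeval a x).

Definition condA1 E M P a b : Prop :=
  forall p, p \in P ->
    (forall x, (M `&` zeros p) x -> mxeval (a *m grad p) x = 0) /\
    (forall x, (E `&` zeros p) x -> 0 < peval (generator a b p) x).

Definition condA2 M Q a b : Prop :=
  forall q, q \in Q ->
    (forall x, M x -> mxeval (a *m grad q) x = 0) /\
    (forall x, M x -> peval (generator a b q) x = 0).

End Diffusion.

Section Simplex.
Variables (R : realType) (d : nat).

Definition simplex : set 'cV[R]_d :=
  [set x | (forall i, 0 <= x i 0) /\ \sum_(i < d) x i 0 = 1].

Definition simplexP : seq {mpoly R[d]} := [seq 'X_i | i <- enum 'I_d].

Definition simplexQ : seq {mpoly R[d]} := [:: 1 - \sum_(i < d) 'X_i].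

Definition simplexM : set 'cV[R]_d := [set x | \sum_(i < d) x i 0 = 1].

Definition ones : 'cV[R]_d := const_mx 1.

End Simplex.

Arguments simplex : clear implicits.
Arguments simplexP : clear implicits.
Arguments simplexQ : clear implicits.
Arguments simplexM : clear implicits.
Arguments ones : clear implicits.

(* Main.v *)
Require Import Defs.
From mathcomp Require Import all_boot all_order all_algebra.
From mathcomp Require Import classical_sets reals.
From mathcomp Require Import mpoly ring lra.

Set Implicit Arguments.
Unset Strict Implicit.
Unset Printing Implicit Defensive.

Import Order.TTheory GRing.Theory Num.Theory.
Local Open Scope ring_scope.

(** The boundary of the simplex kills almost every coefficient of a quadratic
    polynomial.  Write M for the hyperplane where the coordinates sum to 1, and
    call nodes the points (e_k + e_l) / 2, which all lie in the simplex E.  On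
    M a quadratic polynomial agrees with a quadratic form, so its values at the
    nodes determine it there ([quadratic_interpolation], [quadratic_ext]).

    Necessity.  (A1) makes the entry a_ij vanish on M wherever x_i = 0 or
    x_j = 0.  For i != j every node except (e_i + e_j) / 2 is such a point, so
    on M the entry a_ij is a multiple of x_i x_j ([offdiag_of_facets]).  By
    (A2) the rows of a sum to zero on M, which gives the diagonal; nonnegativity
    of a_ii at (e_i + e_j) / 2 gives the sign of alpha_ij.  Since G x_i = b_i
    and G (1 - sum x) = - sum b, reading (A1) and (A2) for G at the vertices
    gives the conditions on the affine map b.

    Sufficiency.  The formula for a, assumed on E, extends to M by the same
    interpolation.  It says that a(x) is the Laplacian matrix of the graph with
    weights alpha_ij x_i x_j: it is positive semidefinite, kills the constant
    vector, and kills e_i as soon as x_i = 0 ([laplacianE], [laplacian_psd]).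
    On M one has b_i = sum_j (beta_i + B_ij) x_j, positive on the facet x_i = 0
    of E because the coefficients with j != i are.

    (G2).  Choose k != i.  Modulo 1 - sum x and x_i, every polynomial f is
    congruent to the one obtained by substituting 0 for x_i and
    1 - sum_(j != i, k) x_j for x_k.  This substitution maps R^d into the
    intersection of M with the hyperplane x_i = 0, so when f vanishes there the
    substituted polynomial vanishes everywhere, hence is zero
    ([mpoly_vanish_eq0]). *)

(** * Polynomial inductions *)

Lemma mpoly_ring_ind (R : comNzRingType) (n : nat) (P : {mpoly R[n]} -> Prop) :
  (forall c, P c%:MP) -> (forall i, P 'X_i) ->
  (forall p q, P p -> P q -> P (p + q)) ->
  (forall p q, P p -> P q -> P (p * q)) -> forall p, P p.
Proof.
move=> PC PX PD PM p; rewrite [p]mpolyE.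
apply: (big_ind P) => [||m _]; [by rewrite -mpolyC0; exact: PC|exact: PD|].
rewrite -mul_mpolyC; apply: (PM _ _ (PC _)); rewrite mpolyXE_id.
apply: (big_ind P) => [||i _]; [by rewrite -mpolyC1; exact: PC|exact: PM|].
elim: (m i) => [|k IHk]; first by rewrite expr0 -mpolyC1; exact: PC.
by rewrite exprS; apply: PM.
Qed.

Lemma Pol_ind (R : realType) (n k : nat) (P : {mpoly R[n]} -> Prop) :
  P 0 -> (forall c p q, P p -> P q -> P (c *: p + q)) ->
  (forall m : 'X_{1..n}, (mdeg m <= k)%N -> P 'X_[m]) ->
  forall p, Pol k p -> P p.
Proof.
move=> P0 PD PX p pk; rewrite [p]mpolyE big_seq.
apply: (big_ind P) => // [q r|m mp]; first by rewrite -{2}[q]scale1r; exact: PD.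
rewrite -[_ *: _]addr0; apply: (PD _ _ _ _ P0); apply: PX.
by rewrite -ltnS; apply: leq_trans (msize_mdeg_lt mp) pk.
Qed.

Lemma mnm_split (n : nat) (m : 'X_{1..n}) k :
  mdeg m = k.+1 -> exists i m', m = (U_(i) + m')%MM /\ mdeg m' = k.
Proof.
move=> mk; have [i mi]: exists i, (0 < m i)%N.
  apply/existsP; apply: contraT; rewrite negb_exists => /forallP m0.
  suff m00 : m = 0%MM by rewrite m00 mdeg0 in mk.
  by apply/mnmP => i; rewrite mnm0E; apply/eqP; rewrite -leqn0 leqNgt.
have le : (U_(i) <= m)%MM.
  by apply/mnm_lepP => j; rewrite mnm1E; case: eqP => // <-.
exists i, (m - U_(i))%MM; split; first by rewrite addmC submK.
by have := mk; rewrite -{1}(submK le) mdegD mdeg1 addn1 => -[].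
Qed.

Lemma mderivXU (R : nzRingType) (n : nat) (i j : 'I_n) :
  ('X_i)^`M(j) = (j == i)%:R :> {mpoly R[n]}.
Proof.
rewrite mderivX mnm1E [j == i]eq_sym; case: eqP => [->|_]; last exact: scale0r.
suff -> : (U_(j) - U_(j) = 0 :> 'X_{1..n})%MM by rewrite scale1r mpolyX0.
by apply/mnmP => k; rewrite mnmBE mnm0E subnn.
Qed.

(** * Polynomials that vanish as functions *)

Section Vanishing.
Variables (R : realType) (n : nat).
Implicit Types f : {mpoly R[n]}.

(** The i-th coordinate line through v, as a substitution of univariate
    polynomials for the variables. *)
Let line (v : 'I_n -> R) (i j : 'I_n) : {poly R} :=
  (v j)%:P + (j == i)%:R *: 'X.

Lemma horner_line f v i t :
  (mmap polyC (line v i) f).[t] = f.@[fun j => v j + (j == i)%:R * t].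
Proof.
elim/mpoly_ring_ind: f => [c|j|p q IHp IHq|p q IHp IHq].
- by rewrite mmapC mevalC hornerC.
- by rewrite mmapX mmap1U mevalXU !hornerE.
- by rewrite mmapD mevalD hornerD IHp IHq.
- by rewrite rmorphM /= mevalM hornerM IHp IHq.
Qed.

Lemma deriv_line f v i :
  (mmap polyC (line v i) f)^`() = mmap polyC (line v i) f^`M(i).
Proof.
elim/mpoly_ring_ind: f => [c|j|p q IHp IHq|p q IHp IHq].
- by rewrite mmapC mderivC mmap0 derivC.
- rewrite mmapX mmap1U mderivXU derivD derivC derivZ derivX add0r alg_polyC.
  by rewrite -mpolyC_nat mmapC eq_sym.
- by rewrite mmapD mderivD derivD IHp IHq mmapD.
- by rewrite rmorphM /= mderivM mmapD derivM IHp IHq !rmorphM.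
Qed.

Lemma poly_eq0_fun (u : {poly R}) : (forall t, u.[t] = 0) -> u = 0.
Proof.
move=> u0; apply/eqP; apply: contraT => uN0.
pose s : seq R := [seq k%:R | k <- iota 0 (size u)].
have := @max_poly_roots _ u s uN0; rewrite size_map size_iota ltnn => -> //.
  by apply/allP => t _; rewrite /root u0.
by rewrite map_inj_uniq ?iota_uniq // => x y /eqP; rewrite eqr_nat => /eqP.
Qed.

(** The restriction of f to a coordinate line is a univariate polynomial with
    infinitely many roots, so it is zero together with its derivative; the
    derivative at the base point is the partial derivative of f. *)
Lemma mderiv_vanish f i :
  (forall v, f.@[v] = 0) -> forall v, (f^`M(i)).@[v] = 0.
Proof.
move=> f0 v; have u0 : mmap polyC (line v i) f = 0.
  by apply: poly_eq0_fun => t; rewrite horner_line.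
have := horner_line f^`M(i) v i 0; rewrite -deriv_line u0 deriv0 horner0 => ->.
by apply: meval_eq => j; rewrite mulr0 addr0.
Qed.

Lemma meval0_mcoeff f : f.@[fun=> 0] = f@_0.
Proof.
elim/mpoly_ring_ind: f => [c|j|p q IHp IHq|p q IHp IHq].
- by rewrite mevalC mcoeffC eqxx mulr1.
- by rewrite mevalXU mcoeffX mnm1_eq0.
- by rewrite mevalD mcoeffD IHp IHq.
- by rewrite mevalM IHp IHq rmorphM.
Qed.

(** All iterated partial derivatives of f vanish at the origin, where up to a
    nonzero factorial they are the coefficients of f. *)
Lemma mpoly_vanish_eq0 f : (forall v, f.@[v] = 0) -> f = 0.
Proof.
move=> f0; apply/mpolyP => m; rewrite mcoeff0.
move: {2}(mdeg m) (erefl (mdeg m)) => k.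
elim: k m f f0 => [|k IHk] m f f0 mk.
  by move/eqP: mk; rewrite mdeg_eq0 => /eqP ->; rewrite -meval0_mcoeff.
have [i [m' [-> mk']]] := mnm_split mk.
have := IHk _ _ (mderiv_vanish i f0) mk'.
by rewrite mcoeff_mderiv addmC => /eqP; rewrite mulrn_eq0 => /eqP.
Qed.

End Vanishing.

(** * Evaluation, gradients and generators of the defining polynomials *)

Section Eval.
Variables (R : realType) (d : nat).
Implicit Types (p f : {mpoly R[d]}) (x : 'cV[R]_d).

Lemma pevalX i x : peval 'X_i x = x i 0. Proof. exact: mevalXU. Qed.
Lemma pevalD p f x : peval (p + f) x = peval p x + peval f x.
Proof. exact: mevalD. Qed.
Lemma pevalB p f x : peval (p - f) x = peval p x - peval f x.
Proof. exact: mevalB. Qed.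
Lemma pevalN p x : peval (- p) x = - peval p x.
Proof. exact: mevalN. Qed.
Lemma pevalM p f x : peval (p * f) x = peval p x * peval f x.
Proof. exact: mevalM. Qed.
Lemma pevalZ c p x : peval (c *: p) x = c * peval p x.
Proof. exact: mevalZ. Qed.
Lemma peval1 x : peval 1 x = 1. Proof. exact: meval1. Qed.
Lemma peval0 x : peval 0 x = 0. Proof. exact: meval0. Qed.
Lemma peval_sum (I : Type) (r : seq I) (P : pred I) F x :
  peval (\sum_(i <- r | P i) F i) x = \sum_(i <- r | P i) peval (F i) x.
Proof. exact: (raddf_sum (meval (fun i => x i 0))). Qed.

Definition pevalE := (pevalX, pevalD, pevalB, pevalN, pevalM, pevalZ, peval1,
                      peval0, peval_sum).

Lemma mxevalM m n k (A : 'M[{mpoly R[d]}]_(m, n)) (B : 'M_(n, k)) x :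
  mxeval (A *m B) x = mxeval A x *m mxeval B x.
Proof.
apply/matrixP => i j; rewrite !mxE peval_sum; apply: eq_bigr => l _.
by rewrite pevalM !mxE.
Qed.

Lemma peval_simplexQ x : peval (1 - \sum_(i < d) 'X_i) x = 1 - \sum_i x i 0.
Proof. by rewrite !pevalE; under eq_bigr do rewrite pevalE. Qed.

Lemma grad_X i : grad 'X_i = delta_mx i 0 :> 'cV[{mpoly R[d]}]_d.
Proof. by apply/matrixP => j k; rewrite !mxE ord1 eqxx andbT mderivXU. Qed.

Lemma grad_simplexQ :
  grad (1 - \sum_(i < d) 'X_i) = const_mx (- 1) :> 'cV[{mpoly R[d]}]_d.
Proof.
apply/matrixP => j k; rewrite !mxE mderivB -mpolyC1 mderivC sub0r; congr (- _).
rewrite (raddf_sum (mderiv j)) (bigD1 j) //= mderivXU eqxx big1 ?addr0 //.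
by move=> i ij; rewrite mderivXU eq_sym (negbTE ij).
Qed.

Lemma mxeval_grad_X i x : mxeval (grad 'X_i) x = delta_mx i 0.
Proof.
apply/matrixP => j k; rewrite grad_X !mxE.
by case: (_ && _); rewrite ?peval1 ?peval0.
Qed.

Lemma mxeval_grad_simplexQ x :
  mxeval (grad (1 - \sum_(i < d) 'X_i)) x = - ones R d.
Proof.
by apply/matrixP => j k; rewrite grad_simplexQ !mxE pevalN peval1.
Qed.

Lemma generator_flat (a : 'M[{mpoly R[d]}]_d) b f :
  (forall i j, (f^`M(i))^`M(j) = 0) -> generator a b f = (b^T *m grad f) 0 0.
Proof.
move=> f0; have h0 : hess f = 0 by apply/matrixP => i j; rewrite !mxE.
by rewrite /generator h0 mulmx0 mxtrace0 scaler0 add0r.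
Qed.

Lemma generator_X (a : 'M[{mpoly R[d]}]_d) b i : generator a b 'X_i = b i 0.
Proof.
rewrite generator_flat => [|j k]; last first.
  by rewrite mderivXU -mpolyC_nat mderivC.
rewrite grad_X mxE (bigD1 i) //= !mxE !eqxx mulr1 big1 ?addr0 // => j ji.
by rewrite !mxE (negbTE ji) mulr0.
Qed.

Lemma generator_simplexQ (a : 'M[{mpoly R[d]}]_d) b :
  generator a b (1 - \sum_(i < d) 'X_i) = - \sum_i b i 0.
Proof.
rewrite generator_flat => [|j k]; last first.
  have /matrixP/(_ j 0) := grad_simplexQ; rewrite !mxE => ->.
  by rewrite mderivN -mpolyC1 mderivC oppr0.
rewrite grad_simplexQ mxE -sumrN; apply: eq_bigr => i _.
by rewrite !mxE mulrN1.
Qed.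

End Eval.

(** * The geometric conditions on the simplex *)

Section Facets.
Variables (R : realType) (d : nat).
Implicit Types (p f : {mpoly R[d]}) (x : 'cV[R]_d).

Lemma simplex_condG1 : (2 <= d)%N -> condG1 (simplexM R d) (simplexQ R d).
Proof.
move=> d2 x _; rewrite /simplexQ /= seq1_free mxeval_grad_simplexQ oppr_eq0.
apply/eqP => /matrixP/(_ (Ordinal (ltnW d2)) 0); rewrite !mxE => /eqP.
by rewrite oner_eq0.
Qed.

Definition cong2 (u v f g : {mpoly R[d]}) :=
  exists c1 c2, f - g = c1 * u + c2 * v.

(** Congruence modulo an ideal is compatible with the ring operations, so it is
    enough to compare a substitution with the identity on the variables. *)
Lemma cong2_comp u v (h : d.-tuple {mpoly R[d]}) :
  (forall i, cong2 u v 'X_i h`_i) -> forall f, cong2 u v f (f \mPo h).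
Proof.
move=> hX; elim/mpoly_ring_ind => [c|i|p q|p q].
- by exists 0, 0; rewrite comp_mpolyC subrr !mul0r addr0.
- by rewrite comp_mpolyXU; exact: hX.
- move=> [p1 [p2 Ep]] [q1 [q2 Eq]]; exists (p1 + q1), (p2 + q2).
  rewrite comp_mpolyD.
  by rewrite opprD addrACA Ep Eq; ring.
move=> [p1 [p2 Ep]] [q1 [q2 Eq]]; set p' := p \mPo h in Ep *.
exists (p1 * q + p' * q1), (p2 * q + p' * q2); rewrite rmorphM /=.
have -> : p * q - p' * (q \mPo h) = (p - p') * q + p' * (q - (q \mPo h)).
  by ring.
by rewrite Ep Eq; ring.
Qed.

Lemma ideal_of2 u v f :
  ideal_of (rcons [:: u] v) f <-> exists c1 c2, f = c1 * u + c2 * v.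
Proof.
split=> [[c ->]|[c1 [c2 ->]]].
  exists (c 0), (c 1); rewrite big_ord_recl big_ord1 /=; congr (_ + c _ * _).
  exact: val_inj.
exists (fun i => if i == 0 :> nat then c1 else c2).
by rewrite big_ord_recl big_ord1.
Qed.

Lemma simplex_condG2 :
  (2 <= d)%N -> condG2 (simplexM R d) (simplexP R d) (simplexQ R d).
Proof.
move=> d2 _ /mapP[i _ ->]; apply/seteqP; split=> f.
  move/ideal_of2 => [c1 [c2 ->]] x [xM]; rewrite /zeros /= pevalX => xi.
  by rewrite pevalD !pevalM peval_simplexQ pevalX xM xi subrr !mulr0 addr0.
move=> f0; apply/ideal_of2.
have [k ki] : exists k : 'I_d, k != i.
  pose i0 := Ordinal (ltnW d2); pose i1 := Ordinal d2.
  by case: (eqVneq i i0) => [->|n0]; [exists i1|exists i0; rewrite eq_sym].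
pose s : {mpoly R[d]} := 1 - \sum_(j < d | (j != i) && (j != k)) 'X_j.
pose h := [tuple if j == i then 0 else if j == k then s else 'X_j | j < d].
have hE (j : 'I_d) : h`_j = if j == i then 0 else if j == k then s else 'X_j.
  by rewrite -tnth_nth tnth_mktuple.
have [|c1 [c2 fE]] := @cong2_comp (1 - \sum_(j < d) 'X_j) 'X_i h _ f.
  move=> j; rewrite hE; case: eqP => [->|_]; first by exists 0, 1; ring.
  case: eqP => [->|_]; last by exists 0, 0; ring.
  (* 'X_k - s = (\sum_j 'X_j - 1) - 'X_i. *)
  exists (-1), (-1).
  have -> : \sum_(j < d) 'X_j = 'X_i + ('X_k + (1 - s)) :> {mpoly R[d]}.
    by rewrite (bigD1 i) //= (bigD1 k) //= /s; ring.
  ring.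
exists c1, c2; rewrite -fE.
suff -> : f \mPo h = 0 by rewrite subr0.
apply: mpoly_vanish_eq0 => v; rewrite comp_mpoly_meval.
have -> : f.@[fun j => (tnth h j).@[v]] = peval f (\col_j (h`_j).@[v]).
  by apply: meval_eq => j; rewrite mxE -tnth_nth.
apply: f0; split; last first.
  by rewrite /zeros /= pevalX mxE hE eqxx meval0.
rewrite /simplexM /= (bigD1 i) //= (bigD1 k) //= !mxE !hE eqxx (negbTE ki) eqxx.
rewrite ?eqxx meval0 add0r /s mevalB meval1 (raddf_sum (meval v)).
rewrite [X in _ + X](eq_bigr (fun j : 'I_d => ('X_j).@[v])); first by ring.
by move=> j /andP[ji jk]; rewrite mxE hE (negbTE ji) (negbTE jk).
Qed.

End Facets.

(** * Quadratic polynomials on the affine hull of the simplex *)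

Section Interpolation.
Variables (R : realType) (d : nat).
Implicit Types (f g : {mpoly R[d]}) (x : 'cV[R]_d).

(** The midpoint of the vertices e_k and e_l, which is e_k when k = l. *)
Definition node (k l : 'I_d) : 'cV[R]_d :=
  \col_i (((i == k)%:R + (i == l)%:R) / 2).

Lemma sum_pick (F : 'I_d -> R) i : \sum_k F k * (i == k)%:R = F i.
Proof.
rewrite (bigD1 i) //= eqxx mulr1 big1 ?addr0 // => k ki.
by rewrite eq_sym (negbTE ki) mulr0.
Qed.

Lemma nodeC k l : node k l = node l k.
Proof. by apply/matrixP => i j; rewrite !mxE addrC. Qed.

Lemma node_off k l i : i != k -> i != l -> node k l i 0 = 0.
Proof. by move=> /negbTE ik /negbTE il; rewrite mxE ik il addr0 mul0r. Qed.

Lemma node_on k l : k != l -> node k l k 0 = 1 / 2.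
Proof. by move=> /negbTE kl; rewrite mxE eqxx kl addr0. Qed.

Lemma node_simplex k l : simplex R d (node k l).
Proof.
split=> [i|]; first by rewrite mxE divr_ge0 ?addr_ge0 ?ler0n.
under eq_bigr do rewrite mxE.
rewrite -mulr_suml big_split /=.
have E m : \sum_(i < d) (i == m)%:R = 1 :> R.
  rewrite -[RHS](sum_pick (fun=> 1) m).
  by apply: eq_bigr => i _; rewrite mul1r eq_sym.
by rewrite !E; field.
Qed.

Lemma simplexWM x : simplex R d x -> simplexM R d x. Proof. by case. Qed.

Lemma sum_node x i : simplexM R d x ->
  \sum_k \sum_l x k 0 * x l 0 * node k l i 0 = x i 0.
Proof.
move=> xM.
have E k l : x k 0 * x l 0 * node k l i 0 =
    x k 0 * (i == k)%:R / 2 * x l 0 + x k 0 / 2 * (x l 0 * (i == l)%:R).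
  by rewrite mxE; field.
under eq_bigr => k _ do under eq_bigr => l _ do rewrite E.
under eq_bigr do rewrite big_split /= -!mulr_sumr sum_pick xM mulr1.
by rewrite big_split /= -!mulr_suml xM sum_pick; field.
Qed.

Lemma sum_node2 x i j : simplexM R d x ->
  \sum_k \sum_l x k 0 * x l 0 * (node k l i 0 * node k l j 0) =
  (x i 0 * x j 0 + x i 0 * (i == j)%:R) / 2.
Proof.
move=> xM.
have E k l : x k 0 * x l 0 * (node k l i 0 * node k l j 0) =
      (x k 0 * (j == k)%:R) * (i == k)%:R / 4 * x l 0
    + x k 0 * (i == k)%:R / 4 * (x l 0 * (j == l)%:R)
    + x k 0 * (j == k)%:R / 4 * (x l 0 * (i == l)%:R)
    + x k 0 / 4 * (x l 0 * (j == l)%:R * (i == l)%:R).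
  by rewrite !mxE; field.
under eq_bigr => k _ do under eq_bigr => l _ do rewrite E.
under eq_bigr do rewrite !big_split /= -!mulr_sumr !sum_pick xM mulr1.
by rewrite !big_split /= -!mulr_suml !sum_pick xM [j == i]eq_sym; field.
Qed.

Lemma nodekk k i : node k k i 0 = (i == k)%:R.
Proof. by rewrite mxE; field. Qed.

(** Using \sum_k x_k = 1, write f on the hyperplane as a quadratic form with
    symmetric matrix q.  Then q_kk = f (e_k), and the value of f at
    (e_k + e_l) / 2 is (q_kk + q_ll + 2 q_kl) / 4; solving for q_kl and summing
    gives the formula.  Both sides being linear in f, it is enough to check it
    on the monomials of degree at most 2. *)
Lemma quadratic_interpolation f x : Pol 2 f -> simplexM R d x ->
  peval f x = 2 * (\sum_k \sum_l x k 0 * x l 0 * peval f (node k l))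
              - \sum_k x k 0 * peval f (node k k).
Proof.
move=> f2 xM; move: f f2; apply: Pol_ind => [|c p q IHp IHq|m].
- under eq_bigr => k _ do under eq_bigr => l _ do rewrite peval0 mulr0.
  under [X in _ - X]eq_bigr => k _ do rewrite peval0 mulr0.
  by rewrite peval0 pair_big /= !sumr_const !mul0rn mulr0 subr0.
- have E k l : x k 0 * x l 0 * peval (c *: p + q) (node k l) =
      c * (x k 0 * x l 0 * peval p (node k l)) +
      x k 0 * x l 0 * peval q (node k l).
    by rewrite pevalD pevalZ; ring.
  under eq_bigr => k _ do under eq_bigr => l _ do rewrite E.
  under eq_bigr => k _ do rewrite big_split -mulr_sumr /=.
  rewrite big_split -mulr_sumr /=.
  under [X in _ - X]eq_bigr => k _ do rewrite pevalD pevalZ mulrDr mulrCA.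
  rewrite [X in _ - X]big_split -mulr_sumr /=.
  rewrite pevalD pevalZ IHp IHq; ring.
case mdegE: (mdeg m) => [|[|[|//]]] _.
- move/eqP: mdegE; rewrite mdeg_eq0 => /eqP ->; rewrite mpolyX0 peval1.
  under eq_bigr => k _ do under eq_bigr => l _ do rewrite peval1 mulr1.
  under eq_bigr => k _ do rewrite -mulr_sumr xM mulr1.
  under [X in _ - X]eq_bigr => k _ do rewrite peval1 mulr1.
  rewrite xM; ring.
- have [i [m' [-> /eqP]]] := mnm_split mdegE; rewrite mdeg_eq0 => /eqP ->.
  rewrite addm0 pevalX.
  under eq_bigr => k _ do (under eq_bigr => l _ do rewrite pevalX).
  under [X in _ - X]eq_bigr => k _ do rewrite pevalX nodekk.
  rewrite sum_node // sum_pick; ring.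
- have [i [m' [-> /mnm_split[j [m'' [-> /eqP]]]]]] := mnm_split mdegE.
  rewrite mdeg_eq0 => /eqP ->; rewrite addm0 mpolyXD pevalM !pevalX.
  under eq_bigr => k _ do (under eq_bigr => l _ do rewrite pevalM !pevalX).
  under [X in _ - X]eq_bigr => k _ do rewrite pevalM !pevalX !nodekk mulrA.
  rewrite sum_node2 // sum_pick.
  by case: eqP => [->|_]; rewrite ?mulr1 ?mulr0; field.
Qed.

Lemma quadratic_ext f g : Pol 2 f -> Pol 2 g ->
  (forall k l, peval f (node k l) = peval g (node k l)) ->
  forall x, simplexM R d x -> peval f x = peval g x.
Proof.
move=> f2 g2 fg x xM; rewrite (quadratic_interpolation f2) //.
rewrite (quadratic_interpolation g2) //; congr (2 * _ - _).
  by apply: eq_bigr => k _; apply: eq_bigr => l _; rewrite fg.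
by apply: eq_bigr => k _; rewrite fg.
Qed.

Lemma affine_interpolation f x : Pol 1 f ->
  peval f x = peval f 0 + \sum_k (peval f (node k k) - peval f 0) * x k 0.
Proof.
move: f; apply: Pol_ind => [|c p q IHp IHq|m].
- by rewrite !peval0 big1 ?addr0 // => k _; rewrite !peval0 subrr mul0r.
- have E k : (peval (c *: p + q) (node k k) - peval (c *: p + q) 0) * x k 0 =
      c * ((peval p (node k k) - peval p 0) * x k 0) +
      (peval q (node k k) - peval q 0) * x k 0.
    by rewrite !pevalD !pevalZ; ring.
  under eq_bigr do rewrite E.
  rewrite big_split -mulr_sumr /= !pevalD !pevalZ IHp IHq; ring.
case mdegE: (mdeg m) => [|[|//]] _.
- move/eqP: mdegE; rewrite mdeg_eq0 => /eqP ->; rewrite mpolyX0 !peval1.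
  by rewrite big1 ?addr0 // => k _; rewrite !peval1 subrr mul0r.
have [i [m' [-> /eqP]]] := mnm_split mdegE; rewrite mdeg_eq0 => /eqP ->.
rewrite addm0 !pevalX mxE add0r -[LHS](sum_pick (fun k => x k 0)).
by apply: eq_bigr => k _; rewrite pevalX nodekk subr0 mulrC.
Qed.

End Interpolation.

Section Degrees.
Variables (R : realType) (d : nat).

Lemma Pol_XX (c : R) (i j : 'I_d) :
  Pol 2 (c *: ('X_i * 'X_j) : {mpoly R[d]}).
Proof.
apply: leq_trans (msizeZ_le _ _) _.
by rewrite -mpolyXD msizeX mdegD !mdeg1.
Qed.

Lemma Pol_sum (I : Type) (r : seq I) (P : pred I) (F : I -> {mpoly R[d]}) n :
  (forall i, P i -> Pol n (F i)) -> Pol n (\sum_(i <- r | P i) F i).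
Proof.
move=> FP; apply: (big_ind (Pol n)) => //; first by rewrite /Pol /= msize0.
by move=> p q pn qn; apply: leq_trans (msizeD_le _ _) _; rewrite geq_max pn qn.
Qed.

End Degrees.

(** * Graph Laplacians *)

Section Laplacian.
Variables (R : realType) (d : nat) (A : 'M[R]_d) (c : 'I_d -> 'I_d -> R).
Hypothesis Aii : forall i, A i i = \sum_(j < d | j != i) c i j.
Hypothesis Aij : forall i j, i != j -> A i j = - c i j.

Lemma laplacianE (v : 'cV[R]_d) i :
  (A *m v) i 0 = \sum_j c i j * (v i 0 - v j 0).
Proof.
rewrite mxE (bigD1 i) //= [RHS](bigD1 i) //= subrr mulr0 add0r Aii mulr_suml.
rewrite -big_split /=; apply: eq_bigr => j ji.
by rewrite Aij 1?eq_sym //; ring.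
Qed.

(** Twice the quadratic form is the sum of squares
    \sum_i \sum_j c_ij (v_i - v_j)^2. *)
Lemma laplacian_psd : (forall i j, c i j = c j i) ->
  (forall i j, 0 <= c i j) -> psd A.
Proof.
move=> csym c0; split=> [|v].
  apply/matrixP => i j; rewrite mxE; case: (eqVneq i j) => [-> //|ij].
  by rewrite (Aij ij) Aij 1?eq_sym // csym.
rewrite -mulmxA mxE.
under eq_bigr => i _ do rewrite laplacianE mxE mulr_sumr.
set S := (X in 0 <= X).
have E : S + S = \sum_i \sum_j c i j * (v i 0 - v j 0) ^+ 2.
  rewrite {2}/S exchange_big -big_split; apply: eq_bigr => i _ /=.
  rewrite -big_split; apply: eq_bigr => j _ /=.
  by rewrite [c j i]csym; ring.
have : 0 <= S + S.
  by rewrite E; do 2![apply: sumr_ge0 => ? _]; rewrite mulr_ge0 ?sqr_ge0.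
lra.
Qed.

End Laplacian.

(** * Diffusion matrices and drifts on the simplex *)

Section Main.
Variables (R : realType) (d : nat).
Implicit Types (a : 'M[{mpoly R[d]}]_d) (b : 'cV[{mpoly R[d]}]_d).
Implicit Types (x : 'cV[R]_d).

Definition laplacian_form a (alpha : 'M[R]_d) x :=
  (forall i, mxeval a x i i =
     \sum_(j < d | j != i) alpha i j * x i 0 * x j 0) /\
  (forall i j, i != j ->
     mxeval a x i j = - (alpha i j * x i 0 * x j 0)).

(** Both sides are quadratic and the nodes lie in the simplex. *)
Lemma laplacian_form_on_M a alpha :
  (forall i j, Pol 2 (a i j)) ->
  (forall x, simplex R d x -> laplacian_form a alpha x) ->
  forall x, simplexM R d x -> laplacian_form a alpha x.
Proof.
move=> a2 aE x xM; split=> [i|i j ij]; rewrite mxE.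
  pose g := \sum_(j < d | j != i) alpha i j *: ('X_i * 'X_j).
  rewrite (@quadratic_ext _ _ _ g) //.
  - by rewrite peval_sum; apply: eq_bigr => j _; rewrite !pevalE mulrA.
  - by apply: Pol_sum => j _; exact: Pol_XX.
  - move=> k l; have := (aE _ (node_simplex R k l)).1 i; rewrite mxE => ->.
    by rewrite peval_sum; apply: eq_bigr => j _; rewrite !pevalE mulrA.
rewrite (@quadratic_ext _ _ _ ((- alpha i j) *: ('X_i * 'X_j))) //.
- by rewrite !pevalE mulrA !mulNr.
- exact: Pol_XX.
- move=> k l; have := (aE _ (node_simplex R k l)).2 i j ij; rewrite mxE => ->.
  by rewrite !pevalE mulrA !mulNr.
Qed.

Section Necessity.
Variable a : 'M[{mpoly R[d]}]_d.
Hypothesis asym : forall x, symmetric_mx (mxeval a x).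
Hypothesis a2 : forall i j, Pol 2 (a i j).
Hypothesis a_facet :
  forall i j x, simplexM R d x -> x i 0 = 0 -> peval (a j i) x = 0.
Hypothesis a_ones :
  forall i x, simplexM R d x -> \sum_j peval (a i j) x = 0.
Hypothesis a_psd : condA0 (simplex R d) a.

Let asymE i j x : peval (a i j) x = peval (a j i) x.
Proof. by have /matrixP/(_ j i) := asym x; rewrite !mxE. Qed.

(** At the node (e_i + e_j) / 2 the product x_i x_j equals 1 / 4. *)
Let alpha : 'M[R]_d :=
  \matrix_(i, j) if i == j then 0 else - 4 * peval (a i j) (node R i j).

(** Every node other than (e_i + e_j) / 2 has a zero i-th or j-th coordinate, so
    both sides vanish there. *)
Lemma offdiag_of_facets i j x : i != j -> simplexM R d x ->
  peval (a i j) x = - alpha i j * (x i 0 * x j 0).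
Proof.
move=> ij xM.
rewrite (@quadratic_ext _ _ _ ((- alpha i j) *: ('X_i * 'X_j))) ?pevalE //.
  exact: Pol_XX.
move=> k l; rewrite !pevalE; have kM := simplexWM (node_simplex R k l).
have [ikl|ikl] := boolP ((i == k) || (i == l)); last first.
  have i0 : node R k l i 0 = 0.
    by move: ikl; rewrite negb_or => /andP[]; exact: node_off.
  by rewrite asymE a_facet // i0 mul0r mulr0.
have [jkl|jkl] := boolP ((j == k) || (j == l)); last first.
  have j0 : node R k l j 0 = 0.
    by move: jkl; rewrite negb_or => /andP[]; exact: node_off.
  by rewrite a_facet // j0 !mulr0.
have -> : node R k l = node R i j.
  move: ij; case/orP: ikl => /eqP ->; case/orP: jkl => /eqP ->;
    rewrite ?eqxx // => _.
  exact: nodeC.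
have nj : node R i j j 0 = 1 / 2 by rewrite nodeC node_on 1?eq_sym.
by rewrite node_on // nj mxE (negbTE ij); field.
Qed.

Lemma diffusion_necessary : exists alpha : 'M[R]_d,
  [/\ forall i j, 0 <= alpha i j, forall i j, alpha i j = alpha j i
    & forall x, simplex R d x -> laplacian_form a alpha x].
Proof.
exists alpha; split=> [i j|i j|x xE].
- rewrite mxE; case: eqP => [//|/eqP ij].
  have nM := simplexWM (node_simplex R i j).
  (* At this node only the i-th and j-th terms of the i-th row sum survive. *)
  have := a_ones i nM; rewrite (bigD1 i) //= (bigD1 j) 1?eq_sym //= big1 ?addr0.
  2: by move=> k /andP[ki kj]; rewrite a_facet // node_off.
  have [_ /(_ (delta_mx i 0))] := a_psd (node_simplex R i j).
  rewrite trmx_delta -rowE -colE !mxE; lra.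
- by rewrite !mxE eq_sym; case: eqP => // _; rewrite asymE nodeC.
have xM := simplexWM xE; split=> [i|i j ij]; last first.
  by rewrite mxE offdiag_of_facets // mulrA !mulNr.
have := a_ones i xM; rewrite (bigD1 i) //= mxE.
move/eqP; rewrite addr_eq0 => /eqP ->.
rewrite -sumrN; apply: eq_bigr => j ji.
by rewrite offdiag_of_facets 1?eq_sym // mulNr opprK mulrA.
Qed.

End Necessity.

Lemma drift_affine b x : (forall i, Pol 1 (b i 0)) ->
  mxeval b x = (\col_i peval (b i 0) 0) +
    (\matrix_(i, k) (peval (b i 0) (node R k k) - peval (b i 0) 0)) *m x.
Proof.
move=> b1; apply/matrixP => i j; rewrite ord1 !mxE affine_interpolation //.
by congr (_ + _); apply: eq_bigr => k _; rewrite mxE.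
Qed.

Lemma sum_affine (beta : 'cV[R]_d) (B : 'M[R]_d) x i : simplexM R d x ->
  (beta + B *m x) i 0 = \sum_j (beta i 0 + B i j) * x j 0.
Proof.
move=> xM; rewrite !mxE -[beta i 0]mulr1 -{1}xM mulr_sumr -big_split /=.
by apply: eq_bigr => j _; rewrite mulr1 mulrDl.
Qed.

(** Since b (e_j) = beta + B e_j, the sum is the total drift at the vertex
    e_j. *)
Lemma conservative_entry (beta : 'cV[R]_d) (B : 'M[R]_d) j :
  (B^T *m ones R d + (beta^T *m ones R d) 0 0 *: ones R d) j 0 =
  \sum_i (beta i 0 + B i j).
Proof.
rewrite !mxE mulr1 addrC -big_split /=.
by apply: eq_bigr => i _; rewrite !mxE !mulr1.
Qed.

End Main.

Theorem proposition6p6 (R : realType) (d : nat) (d_ge2 : (2 <= d)%N) :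
  (condG1 (simplexM R d) (simplexQ R d) /\
   condG2 (simplexM R d) (simplexP R d) (simplexQ R d)) /\
  forall (a : 'M[{mpoly R[d]}]_d) (b : 'cV[{mpoly R[d]}]_d),
    polynomial_coefficients a b ->
    ([/\ condA0 (simplex R d) a,
         condA1 (simplex R d) (simplexM R d) (simplexP R d) a b
       & condA2 (simplexM R d) (simplexQ R d) a b]
     <->
     (exists alpha : 'M[R]_d,
        [/\ forall i j, 0 <= alpha i j,
            forall i j, alpha i j = alpha j i
          & forall x, simplex R d x ->
              (forall i, mxeval a x i i =
                 \sum_(j < d | j != i) alpha i j * x i 0 * x j 0) /\
              (forall i j, i != j ->
                 mxeval a x i j = - (alpha i j * x i 0 * x j 0))]) /\
     (exists (beta : 'cV[R]_d) (B : 'M[R]_d),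
        [/\ forall x, mxeval b x = beta + B *m x,
            B^T *m ones R d + (beta^T *m ones R d) 0 0 *: ones R d = 0
          & forall i j, j != i -> 0 < beta i 0 + B i j])).
Proof.
split; first by split; [exact: simplex_condG1|exact: simplex_condG2].
move=> a b [asym a2 b1].
split=> [[A0 A1 A2]|[[al [al0 als aE]] [be [B [bE cons pos]]]]].
  have XP i : ('X_i : {mpoly R[d]}) \in simplexP R d.
    by apply: (map_f (fun k => 'X_k)); rewrite mem_enum.
  have Qq : 1 - \sum_(i < d) 'X_i \in simplexQ R d by rewrite mem_seq1.
  split.
    apply: diffusion_necessary => // [i j x xM xi|i x xM].
      have [/(_ x) + _] := A1 _ (XP i).
      rewrite /zeros /= pevalX => /(_ (conj xM xi)).
      by rewrite mxevalM mxeval_grad_X -colE => /matrixP/(_ j 0); rewrite !mxE.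
    have [/(_ x xM) + _] := A2 _ Qq.
    rewrite mxevalM mxeval_grad_simplexQ mulmxN.
    move=> /matrixP/(_ i 0); rewrite !mxE => /eqP; rewrite oppr_eq0 => /eqP aE.
    by rewrite -[RHS]aE; apply: eq_bigr => j _; rewrite !mxE mulr1.
  exists (\col_i peval (b i 0) 0),
    (\matrix_(i, k) (peval (b i 0) (node R k k) - peval (b i 0) 0)).
  have bnode i j : (\col_i peval (b i 0) 0) i 0 +
      (\matrix_(i, k) (peval (b i 0) (node R k k) - peval (b i 0) 0)) i j =
      peval (b i 0) (node R j j) by rewrite !mxE; ring.
  split=> [x||i j ji]; first exact: drift_affine.
    apply/matrixP => j k; rewrite ord1 conservative_entry mxE.
    have [_ /(_ _ (simplexWM (node_simplex R j j)))] := A2 _ Qq.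
    rewrite generator_simplexQ pevalN peval_sum => /eqP.
    rewrite oppr_eq0 => /eqP bE; rewrite -[RHS]bE; apply: eq_bigr => i _.
    exact: bnode.
  rewrite bnode; have [_ /(_ (node R j j))] := A1 _ (XP i).
  rewrite generator_X; apply; split; first exact: node_simplex.
  by rewrite /zeros /= pevalX node_off // eq_sym.
have aM := laplacian_form_on_M a2 aE.
have bM x i : peval (b i 0) x = (be + B *m x) i 0 by rewrite -bE mxE.
split.
- move=> x xE; have [aii aij] := aE x xE.
  apply: (laplacian_psd aii aij) => i j; first by rewrite als; ring.
  by rewrite !mulr_ge0 // xE.1.
- move=> _ /mapP[i _ ->]; split=> x [xM]; rewrite /zeros /= pevalX => xi.
    rewrite mxevalM mxeval_grad_X; have [aii aij] := aM x xM.
    apply/matrixP => k l; rewrite ord1 (laplacianE aii aij) [RHS]mxE.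
    rewrite big1 // => j _.
    rewrite !mxE !eqxx !andbT.
    case: (eqVneq k i) => [->|_]; first by rewrite xi mulr0 !mul0r.
    case: (eqVneq j i) => [->|_]; first by rewrite xi mulr0 !mul0r.
    by rewrite subrr mulr0.
  have [x0 x1] := xM; rewrite generator_X bM sum_affine //.
  rewrite (bigD1 i) //= xi mulr0 add0r.
  have term j : j != i -> 0 <= (be i 0 + B i j) * x j 0.
    by move=> ji; rewrite mulr_ge0 // ltW // pos.
  (* A zero sum would force every coordinate of x to vanish. *)
  rewrite lt_neqAle sumr_ge0 // andbT eq_sym; apply/negP => /eqP s0.
  have xj0 j : x j 0 = 0.
    case: (eqVneq j i) => [-> //|ji].
    have /eqP := psumr_eq0P term s0 ji.
    by rewrite mulf_eq0 gt_eqF ?pos //= => /eqP.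
  by move: x1; rewrite big1 // => /eqP; rewrite eq_sym oner_eq0.
- move=> q; rewrite mem_seq1 => /eqP ->; split=> x xM.
    rewrite mxevalM mxeval_grad_simplexQ mulmxN; have [aii aij] := aM x xM.
    apply/matrixP => k l; rewrite ord1 !mxE -[RHS]oppr0; congr (- _).
    have := laplacianE aii aij (ones R d) k; rewrite mxE => ->.
    by rewrite big1 // => j _; rewrite !mxE subrr mulr0.
  rewrite generator_simplexQ pevalN peval_sum.
  under eq_bigr => i _ do rewrite bM sum_affine //.
  rewrite exchange_big big1 ?oppr0 // => j _.
  by rewrite -mulr_suml -conservative_entry cons mxE mul0r.
Qed.
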